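(* Let $m$ be a composite natural number and let $n \geq 2$ be an integer. Then the commuting graphs $\Gamma(\mathrm{GL}(n,\mathbb{Z}_m))$ and $\Gamma(\mathrm{M}(n,\mathbb{Z}_m))$ are connected, and $$\operatorname{diam}(\Gamma(\mathrm{GL}(n,\mathbb{Z}_m)))=\operatorname{diam}(\Gamma(\mathrm{M}(n,\mathbb{Z}_m)))=3.$$
   Context: $\mathbb{Z}_m$ denotes the commutative ring of integers modulo $m$. For a ring $R$, $\mathrm{M}(n,R)$ is the ring of all $n\times n$ matrices over $R$ and $\mathrm{GL}(n,R)$ is the group of all invertible $n\times n$ matrices over $R$. For a group or ring $G$, the center is $\mathcal{Z}(G)=\{x\in G : xy=yx \text{ for all } y\in G\}$ (multiplicative commutation in the ring case). The commuting graph $\Gamma(G)$ is the simple undirected graph whose vertices are the non-central elements of $G$, with two distinct vertices $x,y$ adjacent if and only if $xy=yx$. A graph is connected if there is a path between any two distinct vertices. The distance $\operatorname{d}(x,y)$ is the length (number of edges) of a shortest path from $x$ to $y$, or $\infty$ if no path exists; the diameter $\operatorname{diam}$ of a graph is the maximum distance between two of its vertices. *)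

(* Defs.v *)
From HB Require Import structures.
From mathcomp Require Import all_boot all_order all_algebra all_fingroup.

Set Implicit Arguments.
Unset Strict Implicit.
Unset Printing Implicit Defensive.

Definition composite (m : nat) : bool := (1 < m) && ~~ prime m.

Record sgraph := SGraph {
  vertex :> finType;
  adj : rel vertex;
  adj_sym : symmetric adj;
  adj_irrefl : irreflexive adj }.

Section Graph.
Variable G : sgraph.
Implicit Types (x y : G) (p : seq G).

(* The path visits x :: p, so its number of edges is size p. *)
Definition is_path x y p : bool :=
  [&& path (@adj G) x p, last x p == y & uniq (x :: p)].

Definition connected_graph : Prop :=
  forall x y, x != y -> exists p, is_path x y p.

Definition path_of_length x y (k : nat) : bool :=
  [exists p : k.-tuple G, is_path x y p].

Lemma path_of_length_dec x y : decidable (exists k, path_of_length x y k).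
Proof.
apply: (@decP _ (connect (@adj G) x y)); apply: (iffP connectP).
  case=> p xp ->; case/shortenP: xp => q xq uq _.
  exists (size q); apply/existsP; exists (in_tuple q).
  by rewrite /is_path xq uq eqxx.
by case=> k /existsP[p /and3P[xp /eqP <- _]]; exists p.
Qed.

(* None stands for infinity, in dist as well as in diam. *)
Definition dist x y : option nat :=
  if path_of_length_dec x y is left xy then Some (ex_minn xy) else None.

End Graph.

Definition emax (a b : option nat) : option nat :=
  match a, b with
  | Some i, Some j => Some (maxn i j)
  | _, _ => None
  end.

Definition diam (G : sgraph) : option nat :=
  \big[emax/Some 0]_(x : G) \big[emax/Some 0]_(y : G) dist x y.

Section CommutingGraph.
(* mul is the multiplication of a group or of a ring with carrier T. *)
Variables (T : finType) (mul : T -> T -> T).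

Definition mul_center : {set T} := [set x | [forall y, mul x y == mul y x]].

Definition noncentral : finType := {x : T | x \notin mul_center}.

Definition comm_adj : rel noncentral := fun x y =>
  (x != y) && (mul (val x) (val y) == mul (val y) (val x)).

Lemma comm_adj_sym : symmetric comm_adj.
Proof. by move=> x y; rewrite /comm_adj eq_sym [X in _ && X]eq_sym. Qed.

Lemma comm_adj_irrefl : irreflexive comm_adj.
Proof. by move=> x; rewrite /comm_adj eqxx. Qed.

Definition comm_graph : sgraph := SGraph comm_adj_sym comm_adj_irrefl.

End CommutingGraph.

(* {'GL_n[R]} consists of matrices of size n.-1.+1, so this is GL(n, Z_m)     *)
(* only for 0 < n; likewise 'Z_m is the ring of integers mod m for 1 < m.    *)
Definition GL_graph (n m : nat) : sgraph :=
  comm_graph (fun A B : {'GL_n['Z_m]} => (A * B)%g).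

Definition M_graph (n m : nat) : sgraph :=
  comm_graph (fun A B : 'M['Z_m]_n => (A *m B)%R).

(* Main.v *)
Require Import Defs.
From mathcomp Require Import all_boot all_algebra.

Set Implicit Arguments.
Unset Strict Implicit.
Unset Printing Implicit Defensive.

Import GRing.Theory.

(** Write [m = a * b] as a product of two proper factors. Two matrices of the
    form [a *: Y] and [b *: Z] commute, since both products vanish, and a matrix
    [X] commutes with [a *: X]; so if [a *: X] and [b *: X'] are not central,
    [X], [a *: X], [b *: X'], [X'] is a walk of length 3. If [a *: X] is central,
    then [a *: Y] commutes with [X] for every [Y], and some fixed [Y] with
    [a *: Y] noncentral takes the place of [X].

    To stay inside [GL], the multiple [c *: X] is replaced with
    [contract c X = 1 + c *: (X - 1)], which has the same commutation
    properties ([commr_contract], [commr_contract_orth]). It is invertible along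
    with [X] as soon as [c] is idempotent or squares to zero ([contract_unit]).
    Such pairs of zero divisors exist modulo every composite number
    ([composite_zero_divisors]): if [p] is prime and [m = p * q], take
    [c = d = q] when [p] divides [q], and otherwise the two complementary
    idempotents given by the Chinese remainder theorem.

    For the lower bound, let [J] be the nilpotent shift matrix. Commuting with
    both [J] and its transpose forces a matrix to be scalar
    ([shift_comm_scalar]), so the noncentral matrices [1 + J] and [1 + J^T] have
    no common neighbour. Moreover they do not commute, so they are at distance
    at least 3. They also provide the fixed [Y] above, namely [1 + J].

    Both graphs are instances of one statement,
    [comm_graph_connected_diam3], about a set of elements of an algebra that is
    stable under multiplication and under two such contractions. *)

(** * Distances and diameter *)

Section Distance.
Variable G : sgraph.
Implicit Types (x y z : G) (k l : nat).

(** Unlike [path_of_length], this allows repeated vertices, so that such walks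
    can be concatenated freely. *)
Definition walk_within k x y : Prop :=
  exists2 p, path (@adj G) x p & last x p = y /\ size p <= k.

Lemma walk_within_trans k l x y z :
  walk_within k x y -> walk_within l y z -> walk_within (k + l) x z.
Proof.
case=> p xp [yE sp] [q yq [zE sq]]; exists (p ++ q).
  by rewrite cat_path xp yE yq.
by rewrite last_cat yE size_cat leq_add.
Qed.

Lemma walk_within_path k x y :
  walk_within k x y -> exists2 l, l <= k & path_of_length x y l.
Proof.
case=> p xp [<- sp]; case/shortenP: xp => q xq uq sqp.
have uq' : uniq q by case/andP: uq.
exists (size q); first exact: leq_trans (uniq_leq_size uq' sqp) sp.
by apply/existsP; exists (in_tuple q); rewrite /is_path xq uq eqxx.
Qed.

Lemma walk_within_connected k :
  (forall x y, walk_within k x y) -> connected_graph G.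
Proof.
move=> walk x y _; have [l _ /existsP[p xyp]] := walk_within_path (walk x y).
by exists p.
Qed.

Lemma walk_within_dist k x y :
  walk_within k x y ->
  exists l, [/\ dist x y = Some l, l <= k & path_of_length x y l].
Proof.
case/walk_within_path=> l lk xyl; rewrite /dist.
case: path_of_length_dec => [xy|[]]; last by exists l.
case: ex_minnP => i xyi min_i; exists i; split=> //.
exact: leq_trans (min_i _ xyl) lk.
Qed.

Lemma diam_eq k x0 y0 :
    (forall x y, walk_within k x y) ->
    (forall l, path_of_length x0 y0 l -> k <= l) ->
  diam G = Some k.
Proof.
move=> walk far; pose f x y := odflt 0 (dist x y).
have distE x y : dist x y = Some (f x y).
  by have [l [xyl _ _]] := walk_within_dist (walk x y); rewrite /f xyl.
have f_le x y : f x y <= k.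
  by have [l [xyl ? _]] := walk_within_dist (walk x y); rewrite /f xyl.
have f_ge : k <= f x0 y0.
  have [l [xyl _ ?]] := walk_within_dist (walk x0 y0).
  by rewrite /f xyl; apply: far.
have -> : diam G = Some (\max_x \max_y f x y).
  rewrite (big_morph Some (op1 := emax) (id1 := Some 0)) //.
  apply: eq_bigr => x _.
  rewrite (big_morph Some (op1 := emax) (id1 := Some 0)) //.
  by apply: eq_bigr => y _.
congr Some; apply/eqP; rewrite eqn_leq; apply/andP; split.
  by apply/bigmax_leqP => x _; apply/bigmax_leqP => y _.
apply: leq_trans f_ge _; apply: leq_trans (leq_bigmax x0).
exact: (leq_bigmax y0).
Qed.

End Distance.

(** * Contraction towards the identity *)

Section Contraction.
Local Open Scope ring_scope.
Variables (R : comNzRingType) (A : algType R).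
Implicit Types (c d : R) (x y : A).

(** This is [c *: x] moved into the coset of [1], so that it has a chance of
    being invertible; both have the same centraliser. *)
Definition contract c x : A := 1 + c *: (x - 1).

Lemma contract1 x : contract 1 x = x.
Proof. by rewrite /contract scale1r addrC subrK. Qed.

Lemma commr_contract c x y :
  GRing.comm (contract c x) y <-> c *: (x * y) = c *: (y * x).
Proof.
rewrite /GRing.comm /contract mulrDl mulrDr mul1r mulr1 -scalerAl -scalerAr.
rewrite mulrBl mulrBr mul1r mulr1 !scalerBr.
by split=> [/addrI/addIr|->].
Qed.

Lemma commr_contract_orth c d x y :
  c * d = 0 -> GRing.comm (contract c x) (contract d y).
Proof.
move=> cd0; have dc0 : d * c = 0 by rewrite mulrC.
rewrite /contract; apply: commrD; first exact: commr1.
apply/commr_sym/commrD; first exact: commr1.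
by rewrite /GRing.comm -!scalerAl -!scalerAr !scalerA cd0 dc0 !scale0r.
Qed.

(** If [contract c x] commutes with [y] then [x] commutes with [contract c y]:
    both say that [c] kills the commutator of [x] and [y]. *)
Lemma commr_contractC c x y :
  GRing.comm (contract c x) y -> GRing.comm x (contract c y).
Proof. by move/commr_contract=> xy; apply/commr_sym/commr_contract. Qed.

Lemma comm_contract c x y : GRing.comm x y -> GRing.comm (contract c x) y.
Proof. by move=> xy; apply/commr_contract; rewrite xy. Qed.

End Contraction.

(** * Commuting graphs in an algebra *)

Section CommutingGraphInAlgebra.
Local Open Scope ring_scope.
Variables (R : comNzRingType) (A : algType R).
Variables (T : finType) (mul : T -> T -> T) (f : T -> A).
(** [f] embeds the group or ring [T] as a multiplicative subset of [A], such as
    the units of [A] or [A] itself. *)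
Hypotheses (f_inj : injective f) (fM : {morph f : x y / mul x y >-> x * y}).
Variables u v : T.
Hypothesis uv_central :
  forall a : A, GRing.comm a (f u) -> GRing.comm a (f v) ->
  forall b, GRing.comm a b.
Hypothesis contract_u_v :
  forall c, c != 0 -> ~ GRing.comm (contract c (f u)) (f v).
Variables c d : R.
Hypotheses (c_neq0 : c != 0) (d_neq0 : d != 0) (cd0 : c * d = 0).
Hypothesis contract_c : forall x, exists y, f y = contract c (f x).
Hypothesis contract_d : forall x, exists y, f y = contract d (f x).

Let G := comm_graph mul.

Lemma mul_commP x y : reflect (GRing.comm (f x) (f y)) (mul x y == mul y x).
Proof. by rewrite -(inj_eq f_inj) !fM; apply: eqP. Qed.

Lemma not_mul_center x y :
  ~ GRing.comm (f x) (f y) -> x \notin mul_center mul.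
Proof.
by move=> xy; rewrite inE; apply/forallPn; exists y; apply/mul_commP.
Qed.

Lemma walk_within_comm (x y : G) :
  GRing.comm (f (val x)) (f (val y)) -> walk_within 1 x y.
Proof.
move=> xy; have [<-|x_neq_y] := eqVneq x y; first by exists [::].
exists [:: y] => //=; rewrite andbT; apply/andP; split=> //.
exact/mul_commP.
Qed.

(** The natural choice is the contraction of [x] itself. When that one is
    central, [e] kills the commutator of [x] and [u], so the contraction of [u]
    commutes with [x]; it is not central because of [v]. *)
Lemma contract_neighbour e (x : G) :
    e != 0 -> (forall y, exists z, f z = contract e (f y)) ->
  exists z : G,
    GRing.comm (f (val x)) (f (val z)) /\
    exists y, f (val z) = contract e (f y).
Proof.
move=> e_neq0 contract_e; have [z zE] := contract_e (val x).
have [z_central|z_ncentral] := boolP (z \in mul_center mul); last first.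
  exists (Sub z z_ncentral); rewrite SubK zE; split; last by exists (val x).
  by apply/commr_sym/comm_contract.
have [w wE] := contract_e u.
have w_ncentral : w \notin mul_center mul.
  by apply: (@not_mul_center w v); rewrite wE; apply: contract_u_v.
exists (Sub w w_ncentral); rewrite SubK; split; last by exists u.
rewrite wE; apply: commr_contractC; rewrite -zE; apply/mul_commP.
by move: z_central; rewrite inE => /forallP/(_ u).
Qed.

Lemma comm_graph_walk3 (x y : G) : walk_within 3 x y.
Proof.
have [x' [xx' [x0 x'E]]] := contract_neighbour x c_neq0 contract_c.
have [y' [yy' [y0 y'E]]] := contract_neighbour y d_neq0 contract_d.
apply: (@walk_within_trans _ 1 2 _ x'); first exact: walk_within_comm.
apply: (@walk_within_trans _ 1 1 _ y'); apply: walk_within_comm.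
  by rewrite x'E y'E; apply: commr_contract_orth.
exact: commr_sym.
Qed.

(** The diameter is attained between [u] and [v]: an inner vertex of a path of
    length 2 would be a noncentral element commuting with both. *)
Lemma comm_graph_connected_diam3 : connected_graph G /\ diam G = Some 3.
Proof.
split; first exact: walk_within_connected comm_graph_walk3.
have uv : ~ GRing.comm (f u) (f v).
  by rewrite -[f u](contract1 (f u)); apply/contract_u_v/oner_neq0.
have vu : ~ GRing.comm (f v) (f u) by move/commr_sym.
apply: (@diam_eq G 3 (Sub u (not_mul_center uv)) (Sub v (not_mul_center vu))).
  exact: comm_graph_walk3.
case=> [|[|[|l]]] // /existsP[[p /= /eqP sp]] /and3P[xp /eqP yE _].
- by case: p sp xp yE => //= _ _ [uvE]; case: uv; rewrite uvE.
- case: p sp xp yE => [|y []] //= _ /andP[/andP[_ /mul_commP uy] _].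
  by move: uy => /= /[swap] ->.
case: p sp xp yE => [|z [|y []]] //= _.
case/and3P=> /andP[_ /mul_commP uz] /andP[_ /mul_commP zy] _ yE.
move: zy; rewrite yE /= => zv.
have := valP z; rewrite inE => /forallPn[w /mul_commP[]].
by apply: uv_central => //; apply: commr_sym.
Qed.

End CommutingGraphInAlgebra.

(** * Shift matrices *)

Section Shift.
Local Open Scope ring_scope.
Variables (R : comNzRingType).

Definition shift_mx n : 'M[R]_n := \matrix_(i, j) (i.+1 == j)%:R.

Section Entries.
Variable n : nat.
Implicit Types (X : 'M[R]_n) (i j : 'I_n).

Lemma shift_mulmx X i i' j : i' = i.+1 :> nat ->
  (shift_mx n *m X) i j = X i' j.
Proof.
move=> i'E; rewrite mxE (bigD1 i') //= big1 ?addr0 => [|l li'].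
  by rewrite mxE i'E eqxx mul1r.
by rewrite mxE -i'E eq_sym (inj_eq val_inj) (negbTE li') mul0r.
Qed.

Lemma mulmx_shift X i j j' : j' = j.+1 :> nat ->
  (X *m shift_mx n) i j' = X i j.
Proof.
move=> j'E; rewrite mxE (bigD1 j) //= big1 ?addr0 => [|l lj].
  by rewrite mxE j'E eqxx mulr1.
by rewrite mxE j'E eqSS (inj_eq val_inj) (negbTE lj) mulr0.
Qed.

Lemma mulmx_shift0 X i j : j = 0%N :> nat -> (X *m shift_mx n) i j = 0.
Proof. by move=> j0; rewrite mxE big1 // => l _; rewrite mxE j0 mulr0. Qed.

Section Commutant.
Variable X : 'M[R]_n.
Hypothesis XJ : X *m shift_mx n = shift_mx n *m X.

Lemma shift_comm_toeplitz i j i' j' :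
  i' = i.+1 :> nat -> j' = j.+1 :> nat -> X i' j' = X i j.
Proof.
by move=> i'E j'E; rewrite -(shift_mulmx X j' i'E) -XJ (mulmx_shift X i j'E).
Qed.

Lemma shift_comm_upper i j : (j < i)%N -> X i j = 0.
Proof.
case: i j => [[//|i] lti] [j ltj] /=.
elim: j i lti ltj => [|j IHj] i lti ltj ji.
  by rewrite -(@shift_mulmx X (Ordinal (ltnW lti))) // -XJ mulmx_shift0.
case: i lti ji => // i lti ji.
rewrite (@shift_comm_toeplitz (Ordinal (ltnW lti)) (Ordinal (ltnW ltj))) //.
exact: IHj.
Qed.

Lemma shift_comm_diag i j : X i i = X j j.
Proof.
have X0 k (ltk : (k < n)%N) (lt0 : (0 < n)%N) :
    X (Ordinal ltk) (Ordinal ltk) = X (Ordinal lt0) (Ordinal lt0).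
  elim: k ltk => [|k IHk] ltk; first by congr (X _ _); apply: val_inj.
  by rewrite -(IHk (ltnW ltk)); apply: shift_comm_toeplitz.
have lt0 : (0 < n)%N by apply: leq_trans (ltn_ord i).
by case: i j => [i lti] [j ltj]; rewrite !(X0 _ _ lt0).
Qed.

End Commutant.

End Entries.

(** A matrix commuting with the shift is an upper triangular Toeplitz matrix;
    commuting with the transposed shift makes it lower triangular as well. *)
Lemma shift_comm_scalar n (X : 'M[R]_n) :
    X *m shift_mx n = shift_mx n *m X ->
    X *m (shift_mx n)^T = (shift_mx n)^T *m X ->
  is_scalar_mx X.
Proof.
case: n X => [|n'] X XJ XJt.
  by apply/is_scalar_mxP; exists 0; apply/matrixP => [[]].
have XtJ : X^T *m shift_mx n'.+1 = shift_mx n'.+1 *m X^T.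
  by apply: trmx_inj; rewrite !trmx_mul trmxK.
apply/is_scalar_mxP; exists (X ord0 ord0); apply/matrixP => i j; rewrite !mxE.
have [->|] := eqVneq i j; first exact: shift_comm_diag.
rewrite -(inj_eq val_inj) neq_ltn mulr0n => /orP[ij|ji].
  by have := shift_comm_upper XtJ ij; rewrite mxE.
exact: shift_comm_upper.
Qed.

End Shift.

Section Unipotent.
Local Open Scope ring_scope.

Section ComNzRing.
Variables (R : comNzRingType) (k : nat).
Implicit Types X : 'M[R]_k.+2.

Definition upper_unip : 'M[R]_k.+2 := 1 + shift_mx R k.+2.
Definition lower_unip : 'M[R]_k.+2 := 1 + (shift_mx R k.+2)^T.

Lemma unip_comm_scalar X :
  GRing.comm X upper_unip -> GRing.comm X lower_unip -> is_scalar_mx X.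
Proof.
rewrite /GRing.comm !mulrDr !mulrDl !mulr1 !mul1r => /addrI XJ /addrI XJt.
exact: shift_comm_scalar.
Qed.

Lemma unip_comm_central X :
    GRing.comm X upper_unip -> GRing.comm X lower_unip ->
  forall Y, GRing.comm X Y.
Proof.
move=> Xu Xl Y; have /is_scalar_mxP[a ->] := unip_comm_scalar Xu Xl.
exact: esym (scalar_mxC _ _).
Qed.

(** A contraction of [upper_unip] commutes with [upper_unip]; if it commuted
    with [lower_unip] too it would be scalar, but its entries just above the
    diagonal are [c]. *)
Lemma contract_unip_ncomm (c : R) :
  c != 0 -> ~ GRing.comm (contract c upper_unip) lower_unip.
Proof.
move=> c_neq0 Xl; have Xu := comm_contract c (erefl (upper_unip * upper_unip)).
have /is_scalar_mxP[a /matrixP/(_ ord0 (lift ord0 ord0))] :=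
  unip_comm_scalar Xu Xl.
rewrite /contract /upper_unip (addrC 1 (shift_mx _ _)) addrK !mxE /= mulr1 add0r.
by move/eqP; rewrite (negbTE c_neq0).
Qed.

End ComNzRing.

Section ComUnitRing.
Variables (R : comUnitRingType) (k : nat).
Implicit Types X : 'M[R]_k.+2.

Lemma lower_unip_unit : lower_unip R k \is a GRing.unit.
Proof.
change (lower_unip R k \in unitmx); rewrite unitmxE det_trig.
  rewrite big1 ?unitr1 // => i _.
  by rewrite !mxE eqxx -[i.+1 == i]/(i.+1 == i)%N gtn_eqF // addr0.
apply/is_trig_mxP => i j ij.
by rewrite !mxE -(inj_eq val_inj) ltn_eqF // gtn_eqF ?addr0 // ltnS ltnW.
Qed.

Lemma upper_unip_unit : upper_unip R k \is a GRing.unit.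
Proof.
change (upper_unip R k \in unitmx); rewrite -unitmx_tr.
have -> : (upper_unip R k)^T = lower_unip R k.
  by rewrite raddfD /= -[1 : 'M_k.+2]/(1%:M) trmx1.
exact: lower_unip_unit.
Qed.

(** If [c ^+ 2 = 0] then [c *: (X - 1)] squares to zero and the inverse
    is [contract (- c) X]; if [c] is an idempotent, the ring splits as a
    product, [contract c X] is [X] in one factor and [1] in the other, and the
    inverse is [contract c X^-1]. *)
Lemma contract_unit (c : R) X :
    c * c = 0 \/ c * c = c -> X \is a GRing.unit ->
  contract c X \is a GRing.unit.
Proof.
case=> cc Xunit.
  suff /mulmx1_unit[] : contract c X * contract (- c) X = 1 by [].
  rewrite /contract mulrDl mul1r mulrDr mulr1 -scalerAl -scalerAr scalerA.
  by rewrite mulrN cc oppr0 scale0r addr0 scaleNr subrK.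
suff /mulmx1_unit[] : contract c X * contract c X^-1 = 1 by [].
rewrite /contract mulrDl mul1r mulrDr mulr1 -scalerAl -scalerAr scalerA cc.
rewrite -addrA -!scalerDr -[X in _ + (X + _)](mulr1 (X - 1)) -mulrDr.
rewrite [1 + (_ - 1)]addrC subrK mulrBl mul1r divrr //.
by rewrite -[1 - _]opprB subrr scaler0 addr0.
Qed.

End ComUnitRing.
End Unipotent.

(** * Zero divisors modulo a composite number *)

Section Zm.
Local Open Scope ring_scope.

Lemma natr_Zp_eq0 m a : (1 < m)%N -> (a%:R == 0 :> 'Z_m) = (m %| a)%N.
Proof. by move=> m1; rewrite -val_eqE /= val_Zp_nat. Qed.

(** If the least prime factor [p] of [m] divides [q = m / p], then [m] divides
    [q ^ 2]. Otherwise [p] and [q] are coprime, and the residue that is 1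
    modulo [p] and 0 modulo [q] is a nontrivial idempotent. *)
Lemma composite_zero_divisors m : composite m ->
  exists c d : 'Z_m, [/\ c != 0, d != 0, c * d = 0,
    c * c = 0 \/ c * c = c & d * d = 0 \/ d * d = d].
Proof.
case/andP=> m1 m_nprime.
have [p [q [p_prime q1 mE]]] :
    exists p q, [/\ prime p, (1 < q)%N & m = (p * q)%N].
  exists (pdiv m), (m %/ pdiv m)%N.
  have mE : m = (pdiv m * (m %/ pdiv m))%N by rewrite mulnC divnK ?pdiv_dvd.
  split=> //; first exact: pdiv_prime.
  rewrite ltn_neqAle divn_gt0 ?pdiv_gt0 // dvdn_leq ?pdiv_dvd ?(ltnW m1) //.
  rewrite andbT; apply: contraNneq m_nprime => qE.
  by rewrite mE -qE muln1 pdiv_prime.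
rewrite {m m_nprime}mE in m1 *.
have p1 := prime_gt1 p_prime.
have [pq|pq] := boolP (p %| q)%N.
  have qq0 : (q%:R : 'Z_(p * q)) * q%:R = 0.
    by apply/eqP; rewrite -natrM natr_Zp_eq0 // dvdn_mul.
  have q0 : (q%:R : 'Z_(p * q)) != 0.
    by rewrite natr_Zp_eq0 // gtnNdvd ?(ltnW q1) // ltn_Pmull // ltnW.
  by exists q%:R, q%:R; split=> //; left.
have co : coprime p q by rewrite prime_coprime.
pose a := chinese p q 1 0.
have ap : a = 1 %[mod p] := chinese_modl co 1 0.
have aq : a = 0 %[mod q] := chinese_modr co 1 0.
have cc : (a%:R : 'Z_(p * q)) * a%:R = a%:R.
  rewrite -natrM -(Zp_nat_mod m1) -[RHS](Zp_nat_mod m1); congr _%:R; apply/eqP.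
  rewrite chinese_remainder // -!(modnMm a a) ap aq modnMm mod0n.
  by rewrite eqxx /= mod0n.
have c0 : (a%:R : 'Z_(p * q)) != 0.
  by rewrite natr_Zp_eq0 // Gauss_dvd //= /dvdn ap modn_small //.
have d0 : 1 - (a%:R : 'Z_(p * q)) != 0.
  have p0 : (p%:R : 'Z_(p * q)) != 0.
    by rewrite natr_Zp_eq0 // gtnNdvd ?ltn_Pmulr // prime_gt0.
  apply: contraNneq p0 => /eqP; rewrite subr_eq0 => /eqP aE.
  rewrite -[p%:R]mulr1 {2}aE -natrM natr_Zp_eq0 // dvdn_mul //.
  by rewrite /dvdn aq mod0n.
exists a%:R, (1 - a%:R); split=> //; [|by right|right].
  by rewrite mulrBr mulr1 cc subrr.
by rewrite mulrBr mulr1 mulrBl mul1r cc subrr subr0.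
Qed.

End Zm.

(** * The commuting graphs of GL(n, Z_m) and M(n, Z_m) *)

Theorem theorem1p1 (m n : nat) (hm : composite m) (hn : 2 <= n) :
  connected_graph (GL_graph n m) /\
  connected_graph (M_graph n m) /\
  diam (GL_graph n m) = Some 3 /\
  diam (M_graph n m) = Some 3.
Proof.
case: n hn => [|[|k]] // _.
have [c [d [c0 d0 cd cc dd]]] := composite_zero_divisors hm.
have [GL_conn GL_diam] : connected_graph (GL_graph k.+2 m) /\
    diam (GL_graph k.+2 m) = Some 3.
  have lift X : (X \is a GRing.unit)%R ->
      exists x : {'GL_k.+2['Z_m]}, \val x = X.
    by move=> hX; exists (FinRing.unit _ hX).
  have [u uE] := lift _ (upper_unip_unit 'Z_m k).
  have [v vE] := lift _ (lower_unip_unit 'Z_m k).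
  apply: (@comm_graph_connected_diam3 _ 'M['Z_m]_k.+2 {'GL_k.+2['Z_m]} _ \val
            val_inj _ u v _ _ c d c0 d0 cd) => //.
  - by rewrite uE vE; apply: unip_comm_central.
  - by rewrite uE vE; apply: contract_unip_ncomm.
  - by move=> x; apply/lift/contract_unit/(valP x).
  - by move=> x; apply/lift/contract_unit/(valP x).
have [M_conn M_diam] : connected_graph (M_graph k.+2 m) /\
    diam (M_graph k.+2 m) = Some 3.
  apply: (@comm_graph_connected_diam3 _ 'M['Z_m]_k.+2 'M['Z_m]_k.+2
            (fun X Y => X *m Y)%R id (@inj_id _) _
            (upper_unip _ _) (lower_unip _ _) _ _ c d c0 d0 cd) => //.
  - exact: unip_comm_central.
  - exact: contract_unip_ncomm.
  - by move=> X; exists (contract c X).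
  - by move=> X; exists (contract d X).
by [].
Qed.
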